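(* Let $K$ be a field, $n$ a positive integer, and let $\Lambda\subseteq\Theta_n$ be an index set. If $\Lambda$ has no quadruples associated to it, then all elements of $\mathcal S_\Lambda(K)$ satisfy the Jacobi Identity.
   Context: Notation. $[n]=\{1,\dots,n\}$; $\Upsilon_n=\{(i,j,k)\in[n]^3 : i<j\}$; $\Theta_n=\{(i,j,k)\in[n]^3 : i<j<k\}$. An index set is a subset of $\Upsilon_n$. Fix a basis $x_1,\dots,x_n$ of $K^n$. An element $\alpha\in\wedge^2(K^n)^*\otimes K^n$ is an alternating bilinear map $K^n\times K^n\to K^n$ with structure constants given by $\alpha(x_i,x_j)=\sum_k\alpha_{ij}^k x_k$. $\mathcal S_\Lambda(K)$ is the set of all such $\alpha$ for which, for all $(i,j,k)\in\Upsilon_n$, $\alpha_{ij}^k\ne0$ if and only if $(i,j,k)\in\Lambda$. To a triple $(i,j,k)$ associate the real root vector $\mathbf y_{(i,j,k)}=\mathbf e_i+\mathbf e_j-\mathbf e_k\in\mathbb R^n$. Two triples $\mathbf t_1=(i_1,j_1,k_1),\mathbf t_2=(i_2,j_2,k_2)\in\Theta_n$ form an (unordered) aligned pair if $\langle\mathbf y_{\mathbf t_1},\mathbf y_{\mathbf t_2}\rangle=-1$ (standard inner product). In this case the symmetric difference of $\{i_1,j_1,k_1\}$ and $\{i_2,j_2,k_2\}$ has four elements $q_1<q_2<q_3<q_4$, and $q(\mathbf t_1,\mathbf t_2)=(q_1,q_2,q_3,q_4)$ is the quadruple of the pair. The quadruples associated to $\Lambda$ are those arising from aligned pairs of triples in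 $\Lambda$ (so $\Lambda$ has no quadruples exactly when it contains no aligned pair). The Jacobi Identity for $\alpha$ is $\alpha(\alpha(x,y),z)+\alpha(\alpha(y,z),x)+\alpha(\alpha(z,x),y)=0$ for all $x,y,z\in K^n$. *)

(* Defs.v *)
From mathcomp Require Import all_boot all_order all_algebra.
From mathcomp Require Import reals zify ring.

Set Implicit Arguments.
Unset Strict Implicit.
Unset Printing Implicit Defensive.

Import GRing.Theory Num.Theory.
Local Open Scope ring_scope.

(* [n] is 'I_n, indexed from 0. *)
Notation triple n := ('I_n * 'I_n * 'I_n)%type.

Definition Upsilon (n : nat) : {set triple n} :=
  [set t : triple n | let: (i, j, k) := t in (i < j)%N].

Definition Theta (n : nat) : {set triple n} :=
  [set t : triple n | let: (i, j, k) := t in (i < j < k)%N].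

Definition root_vector (R : realType) (n : nat) (t : triple n) : 'rV[R]_n :=
  let: (i, j, k) := t in delta_mx 0 i + delta_mx 0 j - delta_mx 0 k.

Definition inner_product (R : realType) (n : nat) (u v : 'rV[R]_n) : R :=
  \sum_(l < n) u 0 l * v 0 l.

Definition aligned (R : realType) (n : nat) (t1 t2 : triple n) : Prop :=
  [/\ t1 \in Theta n, t2 \in Theta n
    & inner_product (root_vector R t1) (root_vector R t2) = -1].

Definition triple_set (n : nat) (t : triple n) : {set 'I_n} :=
  let: (i, j, k) := t in [set i; j; k].

Definition symdiff (n : nat) (A B : {set 'I_n}) : {set 'I_n} :=
  (A :\: B) :|: (B :\: A).

(* The enumeration of a subset of 'I_n is increasing, so for an aligned pair
   this is the list [:: q1; q2; q3; q4] with q1 < q2 < q3 < q4; see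
   [size_quadruple] and [sorted_quadruple]. *)
Definition quadruple (n : nat) (t1 t2 : triple n) : seq 'I_n :=
  enum (symdiff (triple_set t1) (triple_set t2)).

Definition associated_quadruple (R : realType) (n : nat)
    (L : {set triple n}) (q : seq 'I_n) : Prop :=
  exists t1 t2 : triple n,
    [/\ t1 \in L, t2 \in L, aligned R t1 t2 & q = quadruple t1 t2].

Definition structure_constant (K : fieldType) (n : nat) (X : n.-tuple 'rV[K]_n)
    (alpha : 'rV[K]_n -> 'rV[K]_n -> 'rV[K]_n) (i j k : 'I_n) : K :=
  coord X k (alpha (tnth X i) (tnth X j)).

Definition alternating (K : fieldType) (n : nat)
    (alpha : 'rV[K]_n -> 'rV[K]_n -> 'rV[K]_n) : Prop :=
  forall x, alpha x x = 0.

Definition in_S (K : fieldType) (n : nat) (X : n.-tuple 'rV[K]_n)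
    (L : {set triple n})
    (alpha : {bilinear 'rV[K]_n -> 'rV[K]_n -> 'rV[K]_n}) : Prop :=
  alternating alpha /\
  forall i j k : 'I_n, (i, j, k) \in Upsilon n ->
    (structure_constant X alpha i j k <> 0 <-> (i, j, k) \in L).

Definition Jacobi_identity (K : fieldType) (n : nat)
    (alpha : 'rV[K]_n -> 'rV[K]_n -> 'rV[K]_n) : Prop :=
  forall x y z,
    alpha (alpha x y) z + alpha (alpha y z) x + alpha (alpha z x) y = 0.

Lemma inner_product_delta (R : realType) (n : nat) (i j : 'I_n) :
  inner_product (delta_mx 0 i) (delta_mx 0 j) = (i == j)%:R :> R.
Proof.
rewrite /inner_product (bigD1 i) //= big1 => [|l /negPf li]; last first.
  by rewrite !mxE li andbF mul0r.
by rewrite addr0 !mxE !eqxx mul1r.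
Qed.

Lemma inner_productC (R : realType) (n : nat) (u v : 'rV[R]_n) :
  inner_product u v = inner_product v u.
Proof. by apply: eq_bigr => l _; rewrite mulrC. Qed.

Lemma inner_productDl (R : realType) (n : nat) (u v w : 'rV[R]_n) :
  inner_product (u + v) w = inner_product u w + inner_product v w.
Proof. by rewrite -big_split; apply: eq_bigr => l _; rewrite mxE mulrDl. Qed.

Lemma inner_productNl (R : realType) (n : nat) (u w : 'rV[R]_n) :
  inner_product (- u) w = - inner_product u w.
Proof. by rewrite -sumrN; apply: eq_bigr => l _; rewrite mxE mulNr. Qed.

Lemma inner_product_root (R : realType) (n : nat) (i1 j1 k1 i2 j2 k2 : 'I_n) :
  inner_product (root_vector R (i1, j1, k1)) (root_vector R (i2, j2, k2)) =
  (((i1 == i2) + (i1 == j2) + (j1 == i2) + (j1 == j2) + (k1 == k2))%N%:Z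
   - ((i1 == k2) + (j1 == k2) + (k1 == i2) + (k1 == j2))%N%:Z)%:~R.
Proof.
rewrite /root_vector !(inner_productDl, inner_productNl).
rewrite ![inner_product (delta_mx _ _) _]inner_productC.
rewrite !(inner_productDl, inner_productNl) !inner_product_delta.
rewrite ![_ == i1]eq_sym ![_ == j1]eq_sym ![_ == k1]eq_sym.
rewrite rmorphB /= -!pmulrn !natrD.
move: ((i1 == i2)%:R : R) ((i1 == j2)%:R : R) ((j1 == i2)%:R : R)
  ((j1 == j2)%:R : R) ((k1 == k2)%:R : R) ((i1 == k2)%:R : R)
  ((j1 == k2)%:R : R) ((k1 == i2)%:R : R) ((k1 == j2)%:R : R).
move=> a b c d e f g h o.
ring.
Qed.

Lemma aligned_overlap (a b c d e f : nat) :
    (a < b < c)%N -> (d < e < f)%N ->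
    ((a == d) + (a == e) + (b == d) + (b == e) + (c == f))%N%:Z
    - ((a == f) + (b == f) + (c == d) + (c == e))%N%:Z = -1 ->
  [\/ c = d /\ [/\ a <> e, a <> f, b <> e & b <> f],
      c = e /\ [/\ a <> d, a <> f, b <> d & b <> f],
      a = f /\ [/\ b <> d, b <> e, c <> d & c <> e]
    | b = f /\ [/\ a <> d, a <> e, c <> d & c <> e]].
Proof.
move=> /andP[/ltP ab /ltP bc] /andP[/ltP de /ltP ef].
do ![case: eqP => ? /=; try by [exfalso; Lia.lia]] => // _.
all: by [constructor 1; do !split; Lia.lia | constructor 2; do !split; Lia.lia
       | constructor 3; do !split; Lia.lia | constructor 4; do !split; Lia.lia].
Qed.

Lemma size_quadruple (R : realType) (n : nat) (t1 t2 : triple n) :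
  aligned R t1 t2 -> size (quadruple t1 t2) = 4.
Proof.
move: t1 t2 => [[i1 j1] k1] [[i2 j2] k2] [].
rewrite !inE /= => lt1 lt2.
rewrite inner_product_root -[-1]/((-1)%:~R) => /intr_inj.
rewrite -!val_eqE => ip; have := aligned_overlap lt1 lt2 ip.
have card4 (m a b c d : 'I_n) (A : {set 'I_n}) :
    uniq [:: m; a; b; c; d] ->
    A =i symdiff [set m; a; b] [set m; c; d] -> size (enum A) = 4.
  rewrite cons_uniq => /andP[mP u4] eA; rewrite -cardE.
  have <- : #|[:: a; b; c; d]| = 4 by rewrite (card_uniqP u4).
  apply: eq_card => x; rewrite eA !inE; move: mP u4; rewrite /= !inE !negb_or.
  case: (eqVneq x m) => [->|_] /=.
    by case/and4P=> /negPf-> /negPf-> /negPf-> /negPf->.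
  move=> _ /and4P[/and3P[_ ac ad] /andP[bc bd] _ _].
  case: (eqVneq x a) => [->|_] /=; first by rewrite (negPf ac) (negPf ad).
  case: (eqVneq x b) => [->|_] /=; first by rewrite (negPf bc) (negPf bd).
  by case: (x == c); case: (x == d).
move=> [[/val_inj e ne]|[/val_inj e ne]|[/val_inj e ne]|[/val_inj e ne]];
  move: lt1 lt2 ne => /andP[/ltP lt1 /ltP lt1'] /andP[/ltP lt2 /ltP lt2'];
  move=> [n1 n2 n3 n4].
- subst i2; apply: (card4 k1 i1 j1 j2 k2).
    by rewrite /= !inE -!val_eqE /= !negb_or; do ?[apply/andP; split=> //];
      apply/eqP; clear ip card4; Lia.lia.
  by move=> x; rewrite !inE;
    case: (x == k1); case: (x == i1); case: (x == j1); case: (x == j2); case: (x == k2).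
- subst j2; apply: (card4 k1 i1 j1 i2 k2).
    by rewrite /= !inE -!val_eqE /= !negb_or; do ?[apply/andP; split=> //];
      apply/eqP; clear ip card4; Lia.lia.
  by move=> x; rewrite !inE; 
    by case: (x == k1); case: (x == i1); case: (x == j1); case: (x == i2); case: (x == k2).
- subst k2; apply: (card4 i1 j1 k1 i2 j2).
    by rewrite /= !inE -!val_eqE /= !negb_or; do ?[apply/andP; split=> //];
      apply/eqP; clear ip card4; Lia.lia.
  by move=> x; rewrite !inE; 
    by case: (x == i1); case: (x == j1); case: (x == k1); case: (x == i2); case: (x == j2).
- subst k2; apply: (card4 j1 i1 k1 i2 j2).
    by rewrite /= !inE -!val_eqE /= !negb_or; do ?[apply/andP; split=> //];
      apply/eqP; clear ip card4; Lia.lia.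
  by move=> x; rewrite !inE; 
    by case: (x == j1); case: (x == i1); case: (x == k1); case: (x == i2); case: (x == j2).
Qed.

Lemma sorted_quadruple (n : nat) (t1 t2 : triple n) :
  sorted (fun i j : 'I_n => (i < j)%N) (quadruple t1 t2).
Proof.
rewrite /quadruple {1}/enum_mem; apply: sorted_filter => [y x z|].
  exact: ltn_trans.
have := iota_ltn_sorted 0 n.
by rewrite -val_enum_ord sorted_map enumT.
Qed.

(* Main.v *)
Require Import Defs.
From HB Require Import structures.
From mathcomp Require Import all_boot all_order all_algebra.
From mathcomp Require Import reals.

(** The Jacobiator J(x, y, z), the left-hand side of the Jacobi identity, is
    trilinear and invariant under cyclic permutations, so it suffices to show
    that it vanishes on basis vectors x_i, x_j, x_k ([jacobiator_eq0]).

    If two of the indices coincide, J vanishes because alpha is alternating: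
    one term is zero and the other two cancel ([jacobiator_alternating]).

    If the indices are distinct, already each of the three terms vanishes
    ([nested_bracket_eq0]).  A nonzero term alpha(alpha(x_i, x_j), x_k) would
    go through some basis vector x_s, giving a triple on {i, j} and s in the
    index set and another one on {s, k} and some t.  Triples in Theta increase,
    so t > s > i, j, and the root vectors e_i + e_j - e_s and e_s + e_k - e_t
    share only the coordinate s, where their product is -1.  The two triples
    thus form an aligned pair, and the index set has none. *)

Set Implicit Arguments.
Unset Strict Implicit.
Unset Printing Implicit Defensive.

Local Open Scope ring_scope.

Import GRing.Theory.

(** * Alternating products and the Jacobiator *)

Definition jacobiator (K : fieldType) (n : nat)
    (alpha : 'rV[K]_n -> 'rV[K]_n -> 'rV[K]_n) (x y z : 'rV[K]_n) :=
  alpha (alpha x y) z + alpha (alpha y z) x + alpha (alpha z x) y.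

Lemma jacobiator_cycle (K : fieldType) (n : nat)
    (alpha : 'rV[K]_n -> 'rV[K]_n -> 'rV[K]_n) (x y z : 'rV[K]_n) :
  jacobiator alpha x y z = jacobiator alpha y z x.
Proof. by rewrite /jacobiator [RHS]addrC addrA. Qed.

Lemma alternating_anticomm (K : fieldType) (n : nat)
    (alpha : {bilinear 'rV[K]_n -> 'rV[K]_n -> 'rV[K]_n}) :
  alternating alpha -> forall x y, alpha x y = - alpha y x.
Proof.
move=> alt x y; apply/eqP; rewrite -addr_eq0; apply/eqP.
by have := alt (x + y); rewrite linearDl !linearDr !alt add0r addr0.
Qed.

Lemma jacobiator_alternating (K : fieldType) (n : nat)
    (alpha : {bilinear 'rV[K]_n -> 'rV[K]_n -> 'rV[K]_n}) :
  alternating alpha -> forall x y, jacobiator alpha x x y = 0.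
Proof.
move=> alt x y.
rewrite /jacobiator alt linear0l add0r.
by rewrite [alpha y x](alternating_anticomm alt) linearNl subrr.
Qed.

Lemma jacobiator_linear (K : fieldType) (n : nat)
    (alpha : {bilinear 'rV[K]_n -> 'rV[K]_n -> 'rV[K]_n}) (y z : 'rV[K]_n) :
  linear (fun x => jacobiator alpha x y z).
Proof.
move=> a u v; rewrite /jacobiator !linearPl !linearPr !linearPl !scalerDr.
by rewrite [X in X + _ = _]addrACA [LHS]addrACA.
Qed.

Lemma linear_basis_eq0 (K : fieldType) (n : nat) (X : n.-tuple 'rV[K]_n)
    (f : 'rV[K]_n -> 'rV[K]_n) :
    basis_of fullv X -> linear f -> (forall i, f (tnth X i) = 0) ->
  forall x, f x = 0.
Proof.
move=> basisX lin_f fX0 x.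
pose F := GRing.isLinear.Build K _ _ _ f lin_f.
pose g : {linear 'rV[K]_n -> 'rV[K]_n} := HB.pack f F.
rewrite -[f]/(g : _ -> _) (coord_basis basisX (memvf x)) linear_sum big1 // => i _.
by rewrite linearZ /= -tnth_nth fX0 scaler0.
Qed.

(** Cyclic invariance lets linearity in one argument serve for all three. *)
Lemma jacobiator_eq0 (K : fieldType) (n : nat) (X : n.-tuple 'rV[K]_n)
    (alpha : {bilinear 'rV[K]_n -> 'rV[K]_n -> 'rV[K]_n}) :
    basis_of fullv X ->
    (forall i j k, jacobiator alpha (tnth X i) (tnth X j) (tnth X k) = 0) ->
  forall x y z, jacobiator alpha x y z = 0.
Proof.
move=> basisX J0 x y z.
apply: (linear_basis_eq0 basisX (jacobiator_linear alpha y z)) => i.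
rewrite jacobiator_cycle.
apply: (linear_basis_eq0 basisX (jacobiator_linear alpha z _)) => j.
rewrite jacobiator_cycle.
apply: (linear_basis_eq0 basisX (jacobiator_linear alpha _ _)) => k.
by rewrite jacobiator_cycle.
Qed.

(** * Nested brackets of basis vectors *)

Lemma bracket_expansion (K : fieldType) (n : nat) (X : n.-tuple 'rV[K]_n)
    (alpha : 'rV[K]_n -> 'rV[K]_n -> 'rV[K]_n) (i j : 'I_n) :
    basis_of fullv X ->
  alpha (tnth X i) (tnth X j) =
    \sum_k structure_constant X alpha i j k *: tnth X k.
Proof.
move=> basisX; rewrite {1}(coord_basis basisX (memvf (alpha _ _))).
by apply: eq_bigr => k _; rewrite -tnth_nth.
Qed.

(** Membership in [in_S] controls only the constants with i < j; the other
    ones reduce to them by anticommutativity. *)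
Lemma structure_constant_support (K : fieldType) (n : nat)
    (X : n.-tuple 'rV[K]_n) (L : {set triple n})
    (alpha : {bilinear 'rV[K]_n -> 'rV[K]_n -> 'rV[K]_n}) (i j k : 'I_n) :
    in_S X L alpha -> structure_constant X alpha i j k <> 0 ->
  (i, j, k) \in L \/ (j, i, k) \in L.
Proof.
move=> [alt supp]; rewrite /structure_constant.
case: (ltngtP i j) => [ij|ji|/val_inj->] nz.
- by left; apply/supp; rewrite ?inE.
- right; apply/supp; rewrite ?inE // => z; apply: nz.
  rewrite alternating_anticomm // linearN /=.
  by move: z; rewrite /structure_constant => ->; rewrite oppr0.
- by case: nz; rewrite alt linear0.
Qed.

Lemma root_vector_swap (R : realType) (n : nat) (i j k : 'I_n) :
  root_vector R (i, j, k) = root_vector R (j, i, k).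
Proof. by rewrite /root_vector [delta_mx _ i + _]addrC. Qed.

(** Since t > s > i, j, the only coordinate that the two root vectors have in
    common is s. *)
Lemma inner_product_consecutive (R : realType) (n : nat) (i j s k t : 'I_n) :
    (i < s)%N -> (j < s)%N -> (s < t)%N -> (k < t)%N ->
    k != i -> k != j -> k != s ->
  inner_product (root_vector R (i, j, s)) (root_vector R (s, k, t)) = -1.
Proof.
move=> lis ljs lst lkt ki kj ks; rewrite inner_product_root eqxx.
have neq (a b : 'I_n) : (a < b)%N -> (a == b) = false.
  by move=> ab; rewrite -val_eqE ltn_eqF.
rewrite ![_ == k]eq_sym (negPf ki) (negPf kj) (negPf ks).
by rewrite !neq // ?(ltn_trans _ lst).
Qed.

Lemma no_consecutive_triples (R : realType) (n : nat) (L : {set triple n})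
    (i j s k t : 'I_n) :
    L \subset Theta n -> (forall q, ~ associated_quadruple R L q) ->
    k != i -> k != j ->
    (i, j, s) \in L \/ (j, i, s) \in L ->
  ~ ((s, k, t) \in L \/ (k, s, t) \in L).
Proof.
move=> /subsetP L_Theta noq ki kj ijs skt.
have lt_ijs : (i < s)%N /\ (j < s)%N.
  by case: ijs => /L_Theta; rewrite inE => /andP[ab bs];
    split=> //; exact: ltn_trans bs.
have [lt_skt ks] : ((s < t)%N /\ (k < t)%N) /\ k != s.
  by case: skt => /L_Theta; rewrite inE => /andP[ab bt];
    rewrite -val_eqE neq_ltn ab ?orbT; do !split=> //; exact: ltn_trans bt.
case: lt_ijs lt_skt => lis ljs [lst lkt].
have ip := inner_product_consecutive R lis ljs lst lkt ki kj ks.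
have no_pair t1 t2 : t1 \in L -> t2 \in L ->
    inner_product (root_vector R t1) (root_vector R t2) <> -1.
  move=> L1 L2 ip12; apply: (noq (quadruple t1 t2)).
  by exists t1, t2; split=> //; split=> //; exact: L_Theta.
case: ijs skt => [L1|L1] [L2|L2]; apply: (no_pair _ _ L1 L2);
  by rewrite ?(root_vector_swap R j i) ?(root_vector_swap R k s).
Qed.

Lemma nested_bracket_eq0 (R : realType) (K : fieldType) (n : nat)
    (X : n.-tuple 'rV[K]_n) (L : {set triple n})
    (alpha : {bilinear 'rV[K]_n -> 'rV[K]_n -> 'rV[K]_n}) (i j k : 'I_n) :
    basis_of fullv X -> L \subset Theta n ->
    (forall q, ~ associated_quadruple R L q) -> in_S X L alpha ->
    k != i -> k != j ->
  alpha (alpha (tnth X i) (tnth X j)) (tnth X k) = 0.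
Proof.
move=> basisX L_Theta noq alpha_S ki kj.
rewrite (bracket_expansion alpha i j basisX) linear_sumlz big1 //= => s _.
rewrite linearZl_LR.
have [->|/eqP/(structure_constant_support alpha_S) ijs] :=
  eqVneq (structure_constant X alpha i j s) 0; first by rewrite scale0r.
rewrite (bracket_expansion alpha s k basisX) big1 ?scaler0 // => t _.
have [->|/eqP/(structure_constant_support alpha_S) skt] :=
  eqVneq (structure_constant X alpha s k t) 0; first by rewrite scale0r.
by case: (no_consecutive_triples L_Theta noq ki kj ijs skt).
Qed.

(** * The Jacobi identity *)

Theorem corollary2p3 (R : realType) (K : fieldType) (n : nat) (n_gt0 : (0 < n)%N)
    (X : n.-tuple 'rV[K]_n) (basisX : basis_of fullv X)
    (L : {set triple n}) (L_Theta : L \subset Theta n)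
    (no_quadruple : forall q : seq 'I_n, ~ associated_quadruple R L q)
    (alpha : {bilinear 'rV[K]_n -> 'rV[K]_n -> 'rV[K]_n})
    (alpha_S : in_S X L alpha) :
  Jacobi_identity alpha.
Proof.
have [alt _] := alpha_S.
apply: (jacobiator_eq0 basisX) => i j k.
have [->|ij] := eqVneq i j; first exact: jacobiator_alternating.
have [->|jk] := eqVneq j k.
  by rewrite jacobiator_cycle jacobiator_alternating.
have [->|ki] := eqVneq k i.
  by rewrite -jacobiator_cycle jacobiator_alternating.
have nested0 a b c := nested_bracket_eq0 (i := a) (j := b) (k := c)
  basisX L_Theta no_quadruple alpha_S.
by rewrite /jacobiator !nested0 ?addr0 // eq_sym.
Qed.
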